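(* For every binary stiffened-gas mixture state (with all quantities as defined in the context), the following alternative formula for the squared speed of sound holds: $$c_s^2=\frac{\gamma}{\rho}\Big\langle\frac{\sigma^{(k)}(\rho(\varepsilon-\varepsilon_0)-p_{*k})}{(p_+ +p_{*k})^2}\Big\rangle^{-1}.$$
   Context: $\langle\cdot\rangle$ denotes summation over $k=1,2$. Physical constants for $k=1,2$: $c_{Vk}>0$, $\gamma_k>1$, $R_k=(\gamma_k-1)c_{Vk}>0$, $p_{*k}\geq 0$, $\varepsilon_{0k}\in\mathbb{R}$. A binary stiffened-gas mixture state consists of component densities $r_k>0$, volume fractions $0<\alpha_k<1$ ($k=1,2$) and a temperature $\theta>0$ such that $\alpha_1+\alpha_2=1$ and the component pressures $p_k=R_kr_k\theta-p_{*k}$ are equal to a common pressure: $p=p_1=p_2>0$. The component specific internal energies are $\varepsilon_k=c_{Vk}\theta+p_{*k}/r_k+\varepsilon_{0k}$. Put $\rho_k=\alpha_kr_k$, $\rho=\langle\rho_k\rangle$, and define $\varepsilon,\varepsilon_0,R,c_V,\gamma$ by $\rho\varepsilon=\langle\rho_k\varepsilon_k\rangle$, $\rho\varepsilon_0=\langle\rho_k\varepsilon_{0k}\rangle$, $\rho R=\langle R_k\rho_k\rangle$, $\rho c_V=\langle c_{Vk}\rho_k\rangle$, $\gamma=R/c_V+1$. Put $\sigma^{(k)}=\dfrac{R_k\rho_k}{c_V\rho}$, so $\langle\sigma^{(k)}\rangle=\gamma-1$, and $$b=\langle\sigma^{(k)}(\rho(\varepsilon-\varepsilon_0)-p_{*k})-p_{*k}\rangle,\qquad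 c=(\sigma^{(1)}p_{*2}+\sigma^{(2)}p_{*1})\rho(\varepsilon-\varepsilon_0)-\gamma p_{*1}p_{*2},\qquad d=b^2+4c.$$ It is known that $d>0$ and that the common pressure is $p=p_+:=\tfrac12(b+\sqrt d)$. The squared speed of sound is defined as $c_s^2:=\partial_\rho p_++\frac{p_+}{\rho^2}\partial_\varepsilon p_+$, where $b$ and $c$ (hence $p_+$) are regarded as functions of $(\rho,\varepsilon)$ with $\varepsilon_0$ and $\sigma^{(1)},\sigma^{(2)}$ (hence also $\gamma=1+\langle\sigma^{(k)}\rangle$) held constant. *)

(* Defs.v *)
From Stdlib Require Import Reals.
From Coquelicot Require Import Coquelicot.

Set Implicit Arguments.
Open Scope R_scope.

Inductive phase : Set := ph1 | ph2.

Definition sumk (f : phase -> R) : R := f ph1 + f ph2.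

Record stiffened_gas : Type := StiffenedGas {
  cV_k : R;
  gamma_k : R;
  pstar_k : R;
  eps0_k : R;
  cV_k_pos : 0 < cV_k;
  gamma_k_gt1 : 1 < gamma_k;
  pstar_k_ge0 : 0 <= pstar_k
}.

Definition R_k (g : stiffened_gas) : R := (gamma_k g - 1) * cV_k g.

Record mixture_state (g : phase -> stiffened_gas) : Type := MixtureState {
  dens : phase -> R;
  vfrac : phase -> R;
  temp : R;
  press : R;
  dens_pos : forall k, 0 < dens k;
  vfrac_bounds : forall k, 0 < vfrac k < 1;
  vfrac_sum : vfrac ph1 + vfrac ph2 = 1;
  temp_pos : 0 < temp;
  press_eq : forall k, R_k (g k) * dens k * temp - pstar_k (g k) = press;
  press_pos : 0 < press
}.

Section Mixture.

Variables (g : phase -> stiffened_gas) (s : mixture_state g).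

Definition pstar (k : phase) : R := pstar_k (g k).

Definition eps_k (k : phase) : R :=
  cV_k (g k) * temp s + pstar_k (g k) / dens s k + eps0_k (g k).

Definition rho_k (k : phase) : R := vfrac s k * dens s k.

Definition rho : R := sumk rho_k.

Definition eps : R := sumk (fun k => rho_k k * eps_k k) / rho.
Definition eps0 : R := sumk (fun k => rho_k k * eps0_k (g k)) / rho.
Definition Rmix : R := sumk (fun k => R_k (g k) * rho_k k) / rho.
Definition cV : R := sumk (fun k => cV_k (g k) * rho_k k) / rho.
Definition gamma : R := Rmix / cV + 1.

Definition sigma_k (k : phase) : R := R_k (g k) * rho_k k / (cV * rho).

End Mixture.

(* The coefficients and the root p_+ as functions of a free density [x] and a
   free specific energy [e]; the remaining arguments are the quantities held
   constant in the partial derivatives defining the speed of sound. *)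

Definition b_fun (sg ps : phase -> R) (e0 x e : R) : R :=
  sumk (fun k => sg k * (x * (e - e0) - ps k) - ps k).

Definition c_fun (sg : phase -> R) (gm : R) (ps : phase -> R) (e0 x e : R) : R :=
  (sg ph1 * ps ph2 + sg ph2 * ps ph1) * (x * (e - e0)) - gm * ps ph1 * ps ph2.

Definition d_fun (sg : phase -> R) (gm : R) (ps : phase -> R) (e0 x e : R) : R :=
  b_fun sg ps e0 x e ^ 2 + 4 * c_fun sg gm ps e0 x e.

Definition p_plus_fun (sg : phase -> R) (gm : R) (ps : phase -> R)
    (e0 x e : R) : R :=
  / 2 * (b_fun sg ps e0 x e + sqrt (d_fun sg gm ps e0 x e)).

Section SoundSpeed.

Variables (g : phase -> stiffened_gas) (s : mixture_state g).

Definition p_plus_at (x e : R) : R :=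
  p_plus_fun (sigma_k s) (gamma s) (pstar g) (eps0 s) x e.

Definition p_plus : R := p_plus_at (rho s) (eps s).

Definition sound_speed_sq : R :=
  Derive (fun x => p_plus_at x (eps s)) (rho s)
  + p_plus / rho s ^ 2 * Derive (fun e => p_plus_at (rho s) e) (eps s).

End SoundSpeed.

(* Main.v *)
Require Import Defs.
From Stdlib Require Import Reals Lra.
From Coquelicot Require Import Coquelicot.
Open Scope R_scope.

(** Both free variables enter [p_plus_fun] only through the product
    [y = x (e - e0)], the energy per unit volume above its reference.
    Multiplied by
    [(p + p*1)(p + p*2)], the rational equation
    [F(p, y) := < sg_k (y - p*k) / (p + p*k) > = 1] becomes exactly
    [p^2 = b p + c], and the bracket of the theorem is [B := - dF/dp].  So, by
    implicit differentiation, [dp/dy = < sg_k / (p + p*k) > / B], and the chain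
    rule turns [dp/dx + p / x^2 dp/de] into [(y + p) / x * dp/dy].  Splitting
    [y + p = (y - p*k) + (p + p*k)] and using [F = 1] once more gives
    [(y + p) < sg_k / (p + p*k) > = 1 + < sg_k > = gamma], which is the formula
    ([sound_speed_of_balance]).

    What remains is that an actual mixture state satisfies [F = 1] and [B > 0]
    at its common pressure.  Both follow from [sg_k T = alpha_k (p + p*k)] and
    [y = T + < alpha_k p*k >], where [T = rho cV theta]: the first is the
    pressure law and the second the definition of the energy.  A single term
    [y - p*k] can be negative, but substituting these relations and grouping
    the two phases shows [B] to be positive ([mixture_bracket_pos]).
    Moreover [2 p - b = (p + p*1)(p + p*2) B], so the sign of [B] is also what
    selects the larger root, i.e. [p = p_+], and makes the discriminant
    positive, so that the square root is differentiable. *)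

(** * The pressure as an implicit function of the energy *)

Definition balance (sg ps : phase -> R) (y p : R) : R :=
  sumk (fun k => sg k * (y - ps k) / (p + ps k)).

(** Minus the derivative of [balance] in [p]. *)
Definition bracket (sg ps : phase -> R) (y p : R) : R :=
  sumk (fun k => sg k * (y - ps k) / (p + ps k) ^ 2).

(** The pressure equation, cleared of denominators. *)
Lemma balance_quadratic (sg ps : phase -> R) (gm e0 x e p : R) :
  (forall k, 0 < p + ps k) -> gm = 1 + sumk sg ->
  balance sg ps (x * (e - e0)) p = 1 ->
  p ^ 2 = b_fun sg ps e0 x e * p + c_fun sg gm ps e0 x e.
Proof.
intros Hp -> HF.
pose proof (Hp ph1) as H1; pose proof (Hp ph2) as H2.
unfold balance, b_fun, c_fun, sumk in *.
assert (Hclear :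
  sg ph1 * (x * (e - e0) - ps ph1) * (p + ps ph2)
  + sg ph2 * (x * (e - e0) - ps ph2) * (p + ps ph1)
  = (p + ps ph1) * (p + ps ph2)).
{ rewrite <- (Rmult_1_r ((p + ps ph1) * (p + ps ph2))), <- HF.
  field; split; lra. }
lra.
Qed.

(** Both sides are the derivative at [p] of
    [(p + p*1)(p + p*2)(1 - balance) = p^2 - b p - c]; on the left the factor
    [1 - balance] vanishes. *)
Lemma balance_slope (sg ps : phase -> R) (e0 x e p : R) :
  (forall k, 0 < p + ps k) ->
  balance sg ps (x * (e - e0)) p = 1 ->
  (p + ps ph1) * (p + ps ph2) * bracket sg ps (x * (e - e0)) p
  = 2 * p - b_fun sg ps e0 x e.
Proof.
intros Hp HF.
pose proof (Hp ph1) as H1; pose proof (Hp ph2) as H2.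
(* The factor of the opposite phase is split as
   [p + p*2 = (2 p + p*1 + p*2) - (p + p*1)], and symmetrically. *)
assert (Hexp : (p + ps ph1) * (p + ps ph2) * bracket sg ps (x * (e - e0)) p
  = (2 * p + ps ph1 + ps ph2) * balance sg ps (x * (e - e0)) p
    - (sg ph1 * (x * (e - e0) - ps ph1) + sg ph2 * (x * (e - e0) - ps ph2))).
{ unfold balance, bracket, sumk; field; split; lra. }
rewrite Hexp, HF; unfold b_fun, sumk; ring.
Qed.

(** The discriminant is the square of the slope [2 p - b], whose positivity
    identifies [p] as the larger root. *)
Lemma sqrt_d_of_balance (sg ps : phase -> R) (gm e0 x e p : R) :
  (forall k, 0 < p + ps k) -> gm = 1 + sumk sg ->
  balance sg ps (x * (e - e0)) p = 1 ->
  0 < bracket sg ps (x * (e - e0)) p ->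
  0 < d_fun sg gm ps e0 x e /\
  sqrt (d_fun sg gm ps e0 x e) = 2 * p - b_fun sg ps e0 x e.
Proof.
intros Hp Hgm HF HB.
pose proof (balance_quadratic sg ps gm e0 x e p Hp Hgm HF) as Hq.
pose proof (balance_slope sg ps e0 x e p Hp HF) as Hs.
assert (Hpos : 0 < 2 * p - b_fun sg ps e0 x e).
{ rewrite <- Hs; repeat apply Rmult_lt_0_compat; auto. }
assert (Hd : d_fun sg gm ps e0 x e = (2 * p - b_fun sg ps e0 x e) ^ 2).
{ unfold d_fun.
  replace (c_fun sg gm ps e0 x e) with (p ^ 2 - b_fun sg ps e0 x e * p) by lra.
  ring. }
rewrite Hd; split; [now apply pow_lt | apply sqrt_pow2; lra].
Qed.

Lemma p_plus_of_balance (sg ps : phase -> R) (gm e0 x e p : R) :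
  (forall k, 0 < p + ps k) -> gm = 1 + sumk sg ->
  balance sg ps (x * (e - e0)) p = 1 ->
  0 < bracket sg ps (x * (e - e0)) p ->
  p_plus_fun sg gm ps e0 x e = p.
Proof.
intros Hp Hgm HF HB; unfold p_plus_fun.
rewrite (proj2 (sqrt_d_of_balance sg ps gm e0 x e p Hp Hgm HF HB)); lra.
Qed.

(** The variables are separated by taking [e0 = 0] and [x = 1]: the last
    argument is then the energy per unit volume itself. *)
Lemma p_plus_fun_energy (sg ps : phase -> R) (gm e0 x e : R) :
  p_plus_fun sg gm ps e0 x e = p_plus_fun sg gm ps 0 1 (x * (e - e0)).
Proof.
unfold p_plus_fun, d_fun, b_fun, c_fun.
now replace (1 * (x * (e - e0) - 0)) with (x * (e - e0)) by ring.
Qed.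

(** The derivative of the explicit root agrees with that given by implicit
    differentiation of [balance = 1]. *)
Lemma is_derive_p_plus_energy (sg ps : phase -> R) (gm y p : R) :
  (forall k, 0 < p + ps k) -> gm = 1 + sumk sg ->
  balance sg ps y p = 1 -> 0 < bracket sg ps y p ->
  is_derive (fun z => p_plus_fun sg gm ps 0 1 z) y
    (sumk (fun k => sg k / (p + ps k)) / bracket sg ps y p).
Proof.
intros Hp Hgm HF HB.
pose proof (Hp ph1) as H1; pose proof (Hp ph2) as H2.
assert (Hy : y = 1 * (y - 0)) by ring.
rewrite Hy in HF, HB.
destruct (sqrt_d_of_balance sg ps gm 0 1 y p Hp Hgm HF HB) as [Hd Hsq].
pose proof (balance_slope sg ps 0 1 y p Hp HF) as Hs.
rewrite <- Hy in HF, HB, Hs.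
(* The derivatives of [b] and [c] in the energy. *)
set (b' := sg ph1 + sg ph2).
set (c' := sg ph1 * ps ph2 + sg ph2 * ps ph1).
assert (Hb : is_derive (fun z => b_fun sg ps 0 1 z) y b').
{ unfold b_fun, sumk, b'; auto_derive; [easy | ring]. }
assert (Hc : is_derive (fun z => c_fun sg gm ps 0 1 z) y c').
{ unfold c_fun, c'; auto_derive; [easy | ring]. }
assert (Hslope : 0 < 2 * p - b_fun sg ps 0 1 y).
{ rewrite <- Hs; repeat apply Rmult_lt_0_compat; auto. }
assert (Hroot : is_derive (fun z => p_plus_fun sg gm ps 0 1 z) y
          ((b' * p + c') / (2 * p - b_fun sg ps 0 1 y))).
{ unfold p_plus_fun, d_fun in *.
  auto_derive.
  - repeat split; try (eexists; eassumption); simpl in Hd; lra.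
  - apply is_derive_unique in Hb; apply is_derive_unique in Hc.
    simpl in Hb, Hc, Hsq; rewrite Hb, Hc, Hsq.
    field; lra. }
replace (sumk (fun k => sg k / (p + ps k)) / bracket sg ps y p)
  with ((b' * p + c') / (2 * p - b_fun sg ps 0 1 y)); [exact Hroot |].
rewrite <- Hs; unfold sumk, b', c'; field; repeat split; lra.
Qed.

(** By the chain rule, the combination of the two partial derivatives is
    [(y + p) / x] times the derivative in [y = x (e - e0)]; the numerator of
    the latter is turned into [gm] by [y + p = (y - p*k) + (p + p*k)] and
    [balance = 1]. *)
Lemma sound_speed_of_balance (sg ps : phase -> R) (gm e0 x e p : R) :
  (forall k, 0 < p + ps k) -> gm = 1 + sumk sg -> 0 < x ->
  balance sg ps (x * (e - e0)) p = 1 ->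
  0 < bracket sg ps (x * (e - e0)) p ->
  exists px pe : R,
    is_derive (fun z => p_plus_fun sg gm ps e0 z e) x px /\
    is_derive (fun z => p_plus_fun sg gm ps e0 x z) e pe /\
    px + p / x ^ 2 * pe = gm / x * / bracket sg ps (x * (e - e0)) p.
Proof.
intros Hp Hgm Hx HF HB.
pose proof (is_derive_p_plus_energy sg ps gm _ p Hp Hgm HF HB) as Hy.
set (G := sumk (fun k => sg k / (p + ps k))) in *.
set (B := bracket sg ps (x * (e - e0)) p) in *.
exists ((e - e0) * (G / B)), (x * (G / B)); split; [| split].
- apply (is_derive_ext
    (fun z => p_plus_fun sg gm ps 0 1 (z * (e - e0)))).
  { intros z; now rewrite <- p_plus_fun_energy. }
  apply (is_derive_comp (fun y => p_plus_fun sg gm ps 0 1 y)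
           (fun z => z * (e - e0))); [exact Hy |].
  auto_derive; [easy | ring].
- apply (is_derive_ext
    (fun z => p_plus_fun sg gm ps 0 1 (x * (z - e0)))).
  { intros z; now rewrite <- p_plus_fun_energy. }
  apply (is_derive_comp (fun y => p_plus_fun sg gm ps 0 1 y)
           (fun z => x * (z - e0))); [exact Hy |].
  auto_derive; [easy | ring].
- assert (HG : (x * (e - e0) + p) * G = gm).
  { rewrite Hgm, <- HF; unfold G, balance, sumk.
    pose proof (Hp ph1); pose proof (Hp ph2); field; split; lra. }
  rewrite <- HG; field; split; lra.
Qed.

(** * The state of a mixture *)

Section MixtureState.

Variables (g : phase -> stiffened_gas) (s : mixture_state g).

Local Notation T := (cV s * rho s * temp s).
Local Notation E := (rho s * (eps s - eps0 s)).

Lemma rho_k_pos (k : phase) : 0 < rho_k s k.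
Proof.
apply Rmult_lt_0_compat; [apply (vfrac_bounds s) | apply (dens_pos s)].
Qed.

Lemma rho_pos : 0 < rho s.
Proof. apply Rplus_lt_0_compat; apply rho_k_pos. Qed.

Lemma cV_rho : cV s * rho s = sumk (fun k => cV_k (g k) * rho_k s k).
Proof. pose proof rho_pos; unfold cV; field; lra. Qed.

Lemma cV_pos : 0 < cV s.
Proof.
apply Rdiv_lt_0_compat; [| exact rho_pos].
apply Rplus_lt_0_compat; apply Rmult_lt_0_compat;
  auto using cV_k_pos, rho_k_pos.
Qed.

Lemma thermal_energy_pos : 0 < T.
Proof.
apply Rmult_lt_0_compat; [| apply temp_pos].
apply Rmult_lt_0_compat; [apply cV_pos | apply rho_pos].
Qed.

Lemma press_plus_pstar_pos (k : phase) : 0 < press s + pstar g k.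
Proof.
pose proof (press_pos s); pose proof (pstar_k_ge0 (g k)); unfold pstar; lra.
Qed.

Lemma gamma_sumk_sigma : gamma s = 1 + sumk (sigma_k s).
Proof.
pose proof rho_pos; pose proof cV_pos.
unfold gamma, Rmix, sigma_k, sumk; field; split; lra.
Qed.

(** The pressure law, weighted by the volume fraction. *)
Lemma sigma_vfrac (k : phase) :
  sigma_k s k = vfrac s k * (press s + pstar g k) / T.
Proof.
pose proof rho_pos; pose proof cV_pos; pose proof (temp_pos s).
rewrite <- (press_eq s k); unfold sigma_k, rho_k, pstar.
field; repeat split; lra.
Qed.

(** The contribution [p*k / r_k] to the specific energy becomes
    [alpha_k p*k] per unit volume. *)
Lemma energy_split : E = T + sumk (fun k => vfrac s k * pstar g k).
Proof.
rewrite cV_rho; pose proof rho_pos.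
pose proof (dens_pos s ph1); pose proof (dens_pos s ph2).
transitivity (sumk (fun k => rho_k s k * (eps_k s k - eps0_k (g k)))).
{ unfold eps, eps0, sumk; field; lra. }
unfold eps_k, rho_k, pstar, sumk; field; split; lra.
Qed.

(** By [sigma_vfrac] the left side is [< alpha_k (E - p*k) > / T], a mean of
    [E - p*k] that [energy_split] evaluates. *)
Lemma mixture_balance : balance (sigma_k s) (pstar g) E (press s) = 1.
Proof.
pose proof thermal_energy_pos as HT; pose proof (vfrac_sum s) as Hv.
pose proof (press_plus_pstar_pos ph1); pose proof (press_plus_pstar_pos ph2).
pose proof energy_split as HE.
unfold balance, sumk; rewrite !sigma_vfrac.
set (T0 := T) in *.
transitivity ((E * (vfrac s ph1 + vfrac s ph2)
  - sumk (fun k => vfrac s k * pstar g k)) / T0).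
{ unfold sumk; field; repeat split; lra. }
rewrite Hv, HE; field; lra.
Qed.

(** With [E - p*1 = T + alpha_2 (p*2 - p*1)] and the symmetric identity, the
    bracket times [T] is [T < alpha_k / (p + p*k) >] plus
    [alpha_1 alpha_2 (p*2 - p*1)^2 / ((p + p*1)(p + p*2))]. *)
Lemma mixture_bracket_pos : 0 < bracket (sigma_k s) (pstar g) E (press s).
Proof.
pose proof thermal_energy_pos as HT; pose proof (vfrac_sum s) as Hv.
pose proof (press_plus_pstar_pos ph1); pose proof (press_plus_pstar_pos ph2).
pose proof (proj1 (vfrac_bounds s ph1)); pose proof (proj1 (vfrac_bounds s ph2)).
assert (Hv2 : vfrac s ph2 = 1 - vfrac s ph1) by lra.
assert (HB : bracket (sigma_k s) (pstar g) E (press s)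
  = vfrac s ph1 / (press s + pstar g ph1)
    + vfrac s ph2 / (press s + pstar g ph2)
    + vfrac s ph1 * vfrac s ph2 * (pstar g ph2 - pstar g ph1) ^ 2
      / ((press s + pstar g ph1) * (press s + pstar g ph2)) / T).
{ unfold bracket, sumk; rewrite !sigma_vfrac, energy_split; unfold sumk.
  (* [T] is kept as one nonzero denominator. *)
  set (T0 := T) in *.
  rewrite Hv2; field; repeat split; lra. }
rewrite HB.
apply Rplus_lt_le_0_compat.
- apply Rplus_lt_0_compat; now apply Rdiv_lt_0_compat.
- apply Rdiv_le_0_compat; [apply Rdiv_le_0_compat |]; try easy.
  + apply Rmult_le_pos; [apply Rmult_le_pos; lra | apply pow2_ge_0].
  + now apply Rmult_lt_0_compat.
Qed.

End MixtureState.

Theorem proposition5 (g : phase -> stiffened_gas) (s : mixture_state g) :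
  let bracket := sumk (fun k =>
             sigma_k s k * (rho s * (eps s - eps0 s) - pstar g k)
             / (p_plus s + pstar g k) ^ 2) in
  ex_derive (fun x => p_plus_at s x (eps s)) (rho s) /\
  ex_derive (fun e => p_plus_at s (rho s) e) (eps s) /\
  bracket <> 0 /\
  sound_speed_sq s = gamma s / rho s * / bracket.
Proof.
pose proof (press_plus_pstar_pos g s) as Hp.
pose proof (gamma_sumk_sigma g s) as Hgm.
pose proof (mixture_balance g s) as HF.
pose proof (mixture_bracket_pos g s) as HB.
assert (Hplus : p_plus s = press s).
{ now apply p_plus_of_balance. }
intros br.
assert (Hbr : br = bracket (sigma_k s) (pstar g)
                     (rho s * (eps s - eps0 s)) (press s)).
{ unfold br; rewrite Hplus; reflexivity. }
destruct (sound_speed_of_balance (sigma_k s) (pstar g) (gamma s) (eps0 s)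
            (rho s) (eps s) (press s) Hp Hgm (rho_pos g s) HF HB)
  as (px & pe & Hx & He & Hc).
split; [| split; [| split]].
- now exists px.
- now exists pe.
- rewrite Hbr; now apply Rgt_not_eq.
- unfold sound_speed_sq; rewrite Hplus, Hbr, <- Hc.
  rewrite (is_derive_unique (fun x : R => p_plus_at s x (eps s)) _ _ Hx).
  now rewrite (is_derive_unique (fun e : R => p_plus_at s (rho s) e) _ _ He).
Qed.
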